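(* Let $T>0$ and let $\alpha\in\mathbb R$, $\alpha\neq0$. The equation $$\varphi''-\varphi+2|\varphi|^2\varphi+i\alpha\varphi=0$$ does not have non-trivial (i.e. not identically zero) classical complex-valued $2T$-periodic solutions $\varphi$.
   Context: Functions are complex-valued functions of $x\in[-T,T]$ with periodic boundary conditions; ''classical'' means twice continuously differentiable. *)

(* Defs.v *)
From Stdlib Require Import Reals.
From Coquelicot Require Import Coquelicot.
Open Scope R_scope.

(* [f] maps the real line to C, so its derivatives are taken over the
   scalars R, with C viewed as the real normed module [C_R_NormedModule]. *)
Definition is_derivative (f df : R -> C) : Prop :=
  forall x : R, @is_derive R_AbsRing C_R_NormedModule f x (df x).

Definition periodic (P : R) (f : R -> C) : Prop :=
  forall x : R, f (x + P) = f x.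

(* Twice continuously differentiable, with first and second derivatives
   [d1] and [d2]; continuity of [f] and [d1] follows from differentiability. *)
Definition C2_with (f d1 d2 : R -> C) : Prop :=
  is_derivative f d1 /\ is_derivative d1 d2 /\
  (forall x : R, @continuous R_UniformSpace C_R_NormedModule d2 x).

Definition classical_solution (alpha : R) (phi : R -> C) : Prop :=
  exists phi' phi'' : R -> C,
    C2_with phi phi' phi'' /\
    forall x : R,
      (phi'' x - phi x + RtoC (2 * Cmod (phi x) ^ 2) * phi x
         + Ci * RtoC alpha * phi x = RtoC 0)%C.

(* Main.v *)
Require Import Defs.
From Stdlib Require Import Reals Lra.
From Coquelicot Require Import Coquelicot.
Open Scope R_scope.

(** The current [J = Im (conj phi * phi')] satisfies [J' = - alpha |phi|^2]:
    the real terms of the equation drop out.  So [alpha * J] is nonincreasing;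
    being periodic it is constant, and its derivative
    [- alpha^2 |phi|^2] vanishes. *)

(** The projection [fst] is real-linear, hence its own differential, and the chain rule applies; the
    same holds for [snd] below. This reduces the complex equation to calculus of real functions. *)
Lemma is_derive_fst (f : R -> C) (x : R) (l : C) :
  @is_derive R_AbsRing C_R_NormedModule f x l ->
  is_derive (fun y => fst (f y)) x (fst l).
Proof.
intros Hf.
apply (filterdiff_comp' (V := C_R_NormedModule) f
         (fst : C -> R) x _ (fst : C -> R) Hf).
apply filterdiff_linear, (is_linear_fst (U := R_NormedModule) (V := R_NormedModule)).
Qed.

Lemma is_derive_snd (f : R -> C) (x : R) (l : C) :
  @is_derive R_AbsRing C_R_NormedModule f x l ->
  is_derive (fun y => snd (f y)) x (snd l).
Proof.
intros Hf.
apply (filterdiff_comp' (V := C_R_NormedModule) f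
         (snd : C -> R) x _ (snd : C -> R) Hf).
apply filterdiff_linear, (is_linear_snd (U := R_NormedModule) (V := R_NormedModule)).
Qed.

(** The two cross terms [u' x * v' x] cancel. With [u] and [v] the real and imaginary parts of a
    complex function, the differentiated expression is its current. *)
Lemma is_derive_wronskian (u v u' v' : R -> R) (x u'' v'' : R) :
  is_derive u x (u' x) -> is_derive v x (v' x) ->
  is_derive u' x u'' -> is_derive v' x v'' ->
  is_derive (fun y => u y * v' y - v y * u' y) x (u x * v'' - v x * u'').
Proof.
intros Hu Hv Hu' Hv'; auto_derive.
- repeat split; eexists; eassumption.
- rewrite (is_derive_unique (fun y : R => u y) _ _ Hu),
    (is_derive_unique (fun y : R => v y) _ _ Hv),
    (is_derive_unique (fun y : R => u' y) _ _ Hu'),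
    (is_derive_unique (fun y : R => v' y) _ _ Hv').
  ring.
Qed.

(** By the chain rule [df (x + P)] is the derivative at [x] of the translate of [f], which is [f]
    itself; uniqueness of derivatives concludes. *)
Lemma derivative_periodic (P : R) (f df : R -> R) :
  (forall x, is_derive f x (df x)) -> (forall x, f (x + P) = f x) ->
  forall x, df (x + P) = df x.
Proof.
intros Hf HP x.
rewrite <- (is_derive_unique _ _ _ (Hf x)).
symmetry; apply is_derive_unique.
apply (is_derive_ext (fun y => f (y + P))); [exact HP |].
auto_derive.
- exists (df (x + P)); apply Hf.
- rewrite (is_derive_unique (fun y : R => f y) _ _ (Hf (x + P))); ring.
Qed.

Lemma nonincreasing_of_derivative (f df : R -> R) :
  (forall x, is_derive f x (df x)) -> (forall x, df x <= 0) ->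
  forall a b, a <= b -> f b <= f a.
Proof.
intros Hf Hneg a b Hab.
destruct (MVT_gen f a b df) as [c [_ Hc]].
- intros x _; apply Hf.
- intros x _; apply continuity_pt_filterlim.
  apply (ex_derive_continuous f); exists (df x); apply Hf.
- specialize (Hneg c); nra.
Qed.

(** On a window of length [P] a monotone [f] is squeezed between equal end values, so it is constant
    there. Centring the window at [x] makes [x] an interior point, so the derivative at [x] is that
    of a constant. *)
Lemma periodic_nonincreasing_derivative_0 (P : R) (f df : R -> R) :
  0 < P -> (forall x, is_derive f x (df x)) -> (forall x, df x <= 0) ->
  (forall x, f (x + P) = f x) -> forall x, df x = 0.
Proof.
intros HP Hf Hneg Hper x.
pose proof (nonincreasing_of_derivative f df Hf Hneg) as Hmon.
assert (Hconst : forall y, x - P / 2 <= y <= x + P / 2 -> f y = f x).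
{ assert (Hends : f (x + P / 2) = f (x - P / 2)).
  { rewrite <- (Hper (x - P / 2)); f_equal; lra. }
  intros y Hy.
  (* Both [f y] and [f x] lie between [f (x + P / 2)] and [f (x - P / 2)], which coincide by
     [Hends]. *)
  pose proof (Hmon (x - P / 2) y); pose proof (Hmon y (x + P / 2)).
  pose proof (Hmon (x - P / 2) x); pose proof (Hmon x (x + P / 2)); lra. }
rewrite <- (is_derive_unique _ _ _ (Hf x)).
apply is_derive_unique.
apply (is_derive_ext_loc (fun _ => f x)).
- assert (HP2 : 0 < P / 2) by lra.
  exists (mkposreal _ HP2); intros y Hy; symmetry; apply Hconst.
  change (Rabs (y - x) < P / 2) in Hy.
  apply Rabs_def2 in Hy; lra.
- apply (is_derive_const (V := R_NormedModule)).
Qed.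

Theorem proposition1 :
  forall T alpha : R, 0 < T -> alpha <> 0 ->
    ~ exists phi : R -> C,
        periodic (2 * T) phi /\
        classical_solution alpha phi /\
        (exists x : R, phi x <> RtoC 0).
Proof.
intros T alpha HT Halpha
  [phi [Hper [[d1 [d2 [[Hd1 [Hd2 _]] Heq]]] [x0 Hx0]]]].
assert (Hu : forall x, is_derive (fun y => fst (phi y)) x (fst (d1 x)))
  by (intros x; apply is_derive_fst, Hd1).
assert (Hv : forall x, is_derive (fun y => snd (phi y)) x (snd (d1 x)))
  by (intros x; apply is_derive_snd, Hd1).
assert (Hu' : forall x, is_derive (fun y => fst (d1 y)) x (fst (d2 x)))
  by (intros x; apply is_derive_fst, Hd2).
assert (Hv' : forall x, is_derive (fun y => snd (d1 y)) x (snd (d2 x)))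
  by (intros x; apply is_derive_snd, Hd2).
pose (J := fun x => fst (phi x) * snd (d1 x) - snd (phi x) * fst (d1 x)).
(* The factor [alpha] in front of [J] makes the derivative carry [alpha ^ 2], so its sign does not
   depend on that of [alpha]. *)
pose (dG := fun x => - alpha ^ 2 * (fst (phi x) ^ 2 + snd (phi x) ^ 2)).
assert (HG : forall x, is_derive (fun y => alpha * J y) x (dG x)).
{ intros x.
  replace (dG x) with
    (alpha * (fst (phi x) * snd (d2 x) - snd (phi x) * fst (d2 x))).
  - apply (is_derive_scal J), (is_derive_wronskian
      (fun y => fst (phi y)) (fun y => snd (phi y))
      (fun y => fst (d1 y)) (fun y => snd (d1 y))); auto.
  - unfold dG.
    (* The real and imaginary parts of the equation are solved for the second derivatives. The
       modulus stays folded as [k]: its terms, like those of [- phi], are real multiples of [phi]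
       and cancel in the final [ring], leaving only the [alpha] terms. *)
    pose proof (f_equal fst (Heq x)) as E1.
    pose proof (f_equal snd (Heq x)) as E2.
    cbn -[pow Cmod] in E1, E2.
    set (k := Cmod (phi x) ^ 2) in *.
    replace (fst (d2 x)) with
      (fst (phi x) - 2 * k * fst (phi x) + alpha * snd (phi x)) by lra.
    replace (snd (d2 x)) with
      (snd (phi x) - 2 * k * snd (phi x) - alpha * fst (phi x)) by lra.
    ring. }
assert (HperG : forall x, alpha * J (x + 2 * T) = alpha * J x).
{ intros x; unfold J; rewrite (Hper x).
  (* Only [phi] is assumed periodic; the factors of [J] coming from [d1] inherit the period. *)
  rewrite (derivative_periodic (2 * T) _ _ Hu),
    (derivative_periodic (2 * T) _ _ Hv);
    [reflexivity | intros y; now rewrite (Hper y) ..]. }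
assert (Hneg : forall x, dG x <= 0) by (intros x; unfold dG; nra).
assert (HP : 0 < 2 * T) by lra.
pose proof (periodic_nonincreasing_derivative_0 _ _ _ HP HG Hneg HperG x0) as H0.
unfold dG in H0.
assert (Hsq : fst (phi x0) ^ 2 + snd (phi x0) ^ 2 = 0).
{ apply Rmult_integral in H0; destruct H0 as [H0 | H0]; [| exact H0].
  exfalso; apply (pow_nonzero alpha 2 Halpha); lra. }
(* A vanishing sum of two real squares forces both components of [phi x0] to be zero. *)
apply Hx0, injective_projections; simpl; nra.
Qed.
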